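(* Let $L$ be the generator, on $L^2(\mu)$, of a strongly continuous Markov semigroup with invariant probability measure $\mu$. Let $$\gamma:=\inf_{f\in\operatorname{Dom}(L)\cap L^2_0(\mu)\setminus\{0\}}\frac{\|Lf\|}{\|f\|},\qquad \gamma_s:=\inf_{f\in\operatorname{Dom}(L)\cap L^2_0(\mu),\ \|f\|=1}\operatorname{Re}\langle f,-Lf\rangle .$$ Then $\gamma_s\le\gamma$.
   Context: $L^2(\mu)$ is the space of complex-valued square-integrable functions on a measurable space $S$, with $\langle f,g\rangle=\int\bar f g\,d\mu$ and norm $\|\cdot\|$; $L^2_0(\mu)=\{g\in L^2(\mu):\int g\,d\mu=0\}$. The semigroup is $P_tg(x)=\mathbb E_x[g(X_t)]$ for a time-homogeneous Markov process on $S$, and $Lg=\lim_{t\downarrow0}(P_tg-g)/t$ with $\operatorname{Dom}(L)$ the set of $g\in L^2(\mu)$ for which the limit exists in $L^2(\mu)$. *)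

(* Defs.v *)
From HB Require Import structures.
From mathcomp Require Import all_boot all_order all_algebra complex.
From mathcomp Require Import all_classical all_reals all_analysis.
From mathcomp Require Import measurable_realfun.
Import Order.TTheory GRing.Theory Num.Theory.
Import numFieldNormedType.Exports.

Set Implicit Arguments.
Unset Strict Implicit.
Unset Printing Implicit Defensive.

Local Open Scope classical_set_scope.
Local Open Scope ring_scope.
Local Open Scope complex_scope.

(* The elements of L^2(mu) are represented by functions S -> R[i]; equality in
   L^2(mu) is equality mu-almost everywhere, and everything below is invariant
   under it (for the semigroup, because mu is invariant). *)

Section ComplexL2.
Context d (S : measurableType d) (R : realType).
Variable mu : {measure set S -> \bar R}.

Definition cmeasurable (f : S -> R[i]) : Prop :=
  measurable_fun setT (fun x => complex.Re (f x)) /\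
  measurable_fun setT (fun x => complex.Im (f x)).

(* A real or imaginary part that is not integrable contributes a junk value. *)
Definition cintegral (f : S -> R[i]) : R[i] :=
  (\int[mu]_x complex.Re (f x)) +i* (\int[mu]_x complex.Im (f x)).

Definition L2norm (f : S -> R[i]) : \bar R :=
  'N[mu]_2%:E[EFin \o (@Normc.normc R \o f)]%E.

Definition L2 : set (S -> R[i]) :=
  [set f | cmeasurable f /\ (L2norm f < +oo)%E].

Definition inner (f g : S -> R[i]) : R[i] :=
  cintegral (fun x => (f x)^* * g x).

Definition L20 : set (S -> R[i]) :=
  [set g | L2 g /\ cintegral g = 0].

Definition L2nonzero : set (S -> R[i]) :=
  [set f | ~ {ae mu, forall x, f x = 0}].

End ComplexL2.

Section MarkovProcess.
Context d (S : measurableType d) (R : realType).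
Context d' (Omega : measurableType d').
Variable X : R -> Omega -> S.
Variable Pr : S -> probability Omega R.

Definition past (s : R) : set (set Omega) :=
  <<s \bigcup_(u in [set u | 0 <= u <= s])
        preimage_set_system setT (X u) measurable >>.

(* Pr x is the law of the process started at x.  Time runs over [0, +oo[; the
   values of X at negative times are irrelevant.  The Markov property is
   required for the natural filtration only, which is its weakest form. *)
Record markov_process : Prop := MarkovProcess {
  mp_measurable : forall t : R, 0 <= t -> measurable_fun setT (X t) ;
  mp_transition : forall (t : R) (A : set S), 0 <= t -> measurable A ->
    measurable_fun setT (fun x => Pr x (X t @^-1` A)) ;
  mp_start : forall x (A : set S), measurable A ->
    Pr x (X 0 @^-1` A) = \d_x A ;
  mp_markov : forall (s t : R) x (A : set S) (E : set Omega),
    0 <= s -> 0 <= t -> measurable A -> past s E ->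
    Pr x (E `&` X (s + t) @^-1` A) =
    (\int[Pr x]_(w in E) Pr (X s w) (X t @^-1` A))%E }.

Definition semigroup (t : R) (g : S -> R[i]) : S -> R[i] :=
  fun x => cintegral (Pr x) (fun w => g (X t w)).

Variable mu : probability S R.

Definition invariant_measure : Prop :=
  forall (t : R) (A : set S), 0 <= t -> measurable A ->
    (\int[mu]_x Pr x (X t @^-1` A))%E = mu A.

(* Strong continuity at 0, which for a semigroup of contractions is strong
   continuity on [0, +oo[. *)
Definition strongly_continuous : Prop :=
  forall f, L2 mu f ->
    L2norm mu (fun x => semigroup t f x - f x) @[t --> 0^'+] --> 0%E.

Definition is_generator_at (f h : S -> R[i]) : Prop :=
  L2 mu h /\
  L2norm mu (fun x => (t^-1)%:C * (semigroup t f x - f x) - h x)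
    @[t --> 0^'+] --> 0%E.

Definition Dom : set (S -> R[i]) :=
  [set f | L2 mu f /\ exists h, is_generator_at f h].

(* The limit in L^2(mu) is unique up to mu-almost everywhere equality. *)
Definition generator (f : S -> R[i]) : S -> R[i] :=
  xget (fun=> 0) [set h | is_generator_at f h].

(* Both infima are over subsets of the extended reals, and are +oo when
   L^2_0(mu) is reduced to 0.  The quotient has finite terms and a nonzero
   denominator, because f is in L^2(mu) and not almost everywhere 0. *)
Definition gap : \bar R :=
  ereal_inf [set (L2norm mu (generator f) / L2norm mu f)%E
            | f in Dom `&` L20 mu `&` L2nonzero mu].

Definition gap_s : \bar R :=
  ereal_inf [set (complex.Re (inner mu f (fun x => - generator f x)))%:E
            | f in Dom `&` L20 mu `&` [set f | L2norm mu f = 1%E]].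

End MarkovProcess.

(* Main.v *)
From HB Require Import structures.
Require Import Defs.
From mathcomp Require Import all_boot all_order all_algebra complex.
From mathcomp Require Import all_classical all_reals all_analysis.
From mathcomp Require Import measurable_realfun.
From mathcomp Require Import ring.
Import Order.TTheory GRing.Theory Num.Theory.
Import numFieldNormedType.Exports.
Import Normc.

Set Implicit Arguments.
Unset Strict Implicit.
Unset Printing Implicit Defensive.

Local Open Scope classical_set_scope.
Local Open Scope ring_scope.

(** The inequality is Cauchy-Schwarz: if [f] has norm 1, then
    Re <f, - L f> <= |f| |L f| = |L f|.  A function [f] admissible for [gap] is
    not almost everywhere 0, so its norm [n] is a positive real, and
    [g := n^-1 f] is admissible for [gap_s]; the term of [gap_s] at [g] is then
    at most |L g| = n^-1 |L f|, which is the term of [gap] at [f].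

    The point needing care is |L g| = n^-1 |L f|.  Since [generator] selects an
    arbitrary representative of a limit in L^2(mu), [L g] and [n^-1 L f] are two
    representatives of the same limit, and need not be equal as functions.  By
    the triangle inequality, two limits of the difference quotients
    t^-1 (P_t g - g) have the same norm ([is_generator_at_L2norm_le]).  The
    triangle inequality holds for measurable functions only, because the
    integral of a nonnegative nonmeasurable function is a lower integral;
    measurability of P_t g comes from the measurability in [x] of the transition
    probabilities ([measurable_expectation]).  That [n^-1 L f] is a
    representative of [L g] is the homogeneity of the semigroup
    ([is_generator_atZ]). *)

(** * The modulus of a complex number *)

Section ComplexModulus.
Variable R : realType.
Implicit Types (c : R) (z w : R[i]).

Lemma ReZ c z : complex.Re (c%:C%C * z) = c * complex.Re z.
Proof. by case: z => a b /=; rewrite mul0r subr0. Qed.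

Lemma ImZ c z : complex.Im (c%:C%C * z) = c * complex.Im z.
Proof. by case: z => a b /=; rewrite mul0r addr0. Qed.

Lemma ReB z w : complex.Re (z - w) = complex.Re z - complex.Re w.
Proof. by case: z; case: w. Qed.

Lemma ImB z w : complex.Im (z - w) = complex.Im z - complex.Im w.
Proof. by case: z; case: w. Qed.

Lemma normc_ge0 z : 0 <= normc z.
Proof. by case: z => a b; exact: sqrtr_ge0. Qed.

Lemma normcZ c z : 0 <= c -> normc (c%:C%C * z) = c * normc z.
Proof.
by move=> c0; rewrite normcM /= expr0n addr0 sqrtr_sqr ger0_norm.
Qed.

Lemma normr_Re_le z : `|complex.Re z| <= normc z.
Proof.
by case: z => a b /=; rewrite -sqrtr_sqr ler_wsqrtr// lerDl sqr_ge0.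
Qed.

Lemma normc_conj z : normc (z^*)%C = normc z.
Proof. by case: z => a b /=; rewrite sqrrN. Qed.

Lemma normc_subC z w : normc (z - w) = normc (w - z).
Proof. by rewrite -opprB (normcN (w - z)). Qed.

End ComplexModulus.

(** * Norm and inner product of complex functions *)

Section ComplexL2Theory.
Context d (S : measurableType d) (R : realType).
Variable mu : {measure set S -> \bar R}.
Implicit Types (f g h : S -> R[i]) (u : S -> R) (c : R).

Lemma cmeasurable_normc f :
  cmeasurable f -> measurable_fun setT (@normc R \o f).
Proof.
case=> mRe mIm.
(* [normc] is defined by matching on its argument; the equality below exposes
   it as a composition of measurable operations. *)
rewrite (_ : _ \o f = fun x =>
    Num.sqrt (complex.Re (f x) ^+ 2 + complex.Im (f x) ^+ 2)).
  apply: (measurableT_comp (continuous_measurable_fun (@sqrt_continuous R))).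
  by apply: measurable_funD; apply: measurable_funX.
by apply/funext => x /=; case: (f x).
Qed.

Lemma cmeasurableZ c f :
  cmeasurable f -> cmeasurable (fun x => c%:C%C * f x).
Proof.
case=> mRe mIm; split.
- under eq_fun do rewrite ReZ; exact: measurable_funM.
- under eq_fun do rewrite ImZ; exact: measurable_funM.
Qed.

Lemma cmeasurableB f g :
  cmeasurable f -> cmeasurable g -> cmeasurable (fun x => f x - g x).
Proof.
case=> mRf mIf [mRg mIg]; split.
- under eq_fun do rewrite ReB; exact: measurable_funB.
- under eq_fun do rewrite ImB; exact: measurable_funB.
Qed.

Lemma cmeasurableN f : cmeasurable f -> cmeasurable (fun x => - f x).
Proof.
case=> mRe mIm; split.
- under eq_fun do rewrite raddfN; exact: measurableT_comp.
- under eq_fun do rewrite raddfN; exact: measurableT_comp.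
Qed.

(** Unlike [RintegralZl] this asks for no integrability: the extended
    integrals of the positive and negative parts are both multiplied by
    [c >= 0], and [fine] sends an infinite value of their difference to 0 before
    and after.  Hence it applies under every law
    [Pr x], even where the composite of a function of [L2 mu] with the process
    is not integrable. *)
Lemma RintegralZ_ge0 u c : measurable_fun setT u -> 0 <= c ->
  \int[mu]_x (c * u x) = c * \int[mu]_x u x.
Proof.
move=> /measurable_EFinP mu_u c0; rewrite /Rintegral.
have -> : (\int[mu]_x (c * u x)%:E = c%:E * \int[mu]_x (u x)%:E)%E.
  pose v := EFin \o u; change (\int[mu]_x (c%:E * v x) = c%:E * \int[mu]_x v x)%E.
  rewrite integralE [in RHS]integralE.
  rewrite ge0_funeposM// ge0_funenegM// !ge0_integralZl_EFin//;
    try exact: measurable_funepos; try exact: measurable_funeneg.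
  have [->|cn0] := eqVneq c 0; first by rewrite !mul0e sube0.
  have cp : 0 < c by rewrite lt0r cn0.
  have := @integral_ge0 _ _ _ mu setT _ (fun x _ => funepos_ge0 v x).
  have := @integral_ge0 _ _ _ mu setT _ (fun x _ => funeneg_ge0 v x).
  case: (integral _ _ (funeneg _)) => [a||]; case: (integral _ _ (funepos _)) => [b||] //= _ _;
   by rewrite ?gt0_muley ?gt0_muleNy ?lte_fin// -?EFinM -?EFinB ?mulrBr.
have [->|cn0] := eqVneq c 0; first by rewrite mul0e mul0r.
have cp : 0 < c by rewrite lt0r cn0.
case: (integral _ _ _) => [a||] //;
  by rewrite ?gt0_muley ?gt0_muleNy ?lte_fin//= mulr0.
Qed.

Lemma cintegralZ c f : cmeasurable f -> 0 <= c ->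
  cintegral mu (fun x => c%:C%C * f x) = c%:C%C * cintegral mu f.
Proof.
case=> mRe mIm c0; rewrite /cintegral.
under eq_Rintegral do rewrite ReZ.
under [X in (_ +i* X)%C]eq_Rintegral do rewrite ImZ.
rewrite !RintegralZ_ge0//.
by apply/eqP; rewrite eq_complex /= !mul0r subr0 addr0 !eqxx.
Qed.

Lemma L2norm_ge0 f : (0 <= L2norm mu f)%E.
Proof. exact: Lnorm_ge0. Qed.

Lemma eq_L2norm f g : (forall x, normc (f x) = normc (g x)) ->
  L2norm mu f = L2norm mu g.
Proof. by move=> fg; apply: eq_Lnorm => x /=; rewrite fg. Qed.

Lemma L2normZ c f : cmeasurable f -> 0 <= c ->
  L2norm mu (fun x => c%:C%C * f x) = (c%:E * L2norm mu f)%E.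
Proof.
move=> /cmeasurable_normc mf c0; rewrite /L2norm !unlock.
have normE x : (`|(normc (c%:C%C * f x))%:E| `^ 2 =
    c%:E `^ 2 * `|(normc (f x))%:E| `^ 2)%E.
  by rewrite normcZ// EFinM abseM poweRM// (gee0_abs _) ?lee_fin.
under eq_integral do rewrite normE.
have i0 : (0 <= \int[mu]_x (`|(normc (f x))%:E| `^ 2))%E.
  by apply: integral_ge0 => x _; exact: poweR_ge0.
rewrite ge0_integralZl//; last 3 first.
- apply: (measurableT_comp (measurable_poweR _)).
  by apply: measurableT_comp => //; apply/measurable_EFinP.
- by move=> x _; exact: poweR_ge0.
- exact: poweR_ge0.
rewrite poweRM// ?poweR_ge0//; congr (_ * _)%E.
by rewrite -poweRrM mulfV// poweRe1.
Qed.

(** The triangle inequality, in a form that combines the monotonicity of the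
    norm with Minkowski's inequality for the real functions [normc \o g] and
    [normc \o h].  It serves both for [f = g + h] and for the differences met
    in comparing two limits. *)
Lemma le_L2norm_add f g h : cmeasurable f -> cmeasurable g -> cmeasurable h ->
  (forall x, normc (f x) <= normc (g x) + normc (h x)) ->
  (L2norm mu f <= L2norm mu g + L2norm mu h)%E.
Proof.
move=> /cmeasurable_normc mf /cmeasurable_normc mg /cmeasurable_normc mh fgh.
have mgh := measurable_funD mg mh.
apply: (@le_trans _ _
  'N[mu]_2%:E[EFin \o ((@normc R \o g) \+ (@normc R \o h))%R]%E); last first.
  by apply: minkowski_EFin => //; rewrite ler1n.
have mpow k : measurable_fun setT k ->
    measurable_fun setT (fun x : S => (`|(k x : R)%:E| `^ 2)%E).
  move=> mk; apply: (measurableT_comp (measurable_poweR _)).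
  by apply: measurableT_comp => //; apply/measurable_EFinP.
rewrite /L2norm !unlock; apply: gt0_ler_poweR; rewrite ?invr_ge0//.
- by rewrite in_itv /= leey andbT integral_ge0// => x _; exact: poweR_ge0.
- by rewrite in_itv /= leey andbT integral_ge0// => x _; exact: poweR_ge0.
apply: ge0_le_integral => //; [|exact: mpow|exact: mpow|].
  by move=> x _; exact: poweR_ge0.
move=> x _; apply: gt0_ler_poweR => //.
- by rewrite in_itv /= leey andbT.
- by rewrite in_itv /= leey andbT.
by rewrite lee_fin /= !ger0_norm ?normc_ge0 ?addr_ge0 ?normc_ge0.
Qed.

(** Cauchy-Schwarz, as the case p = q = 2 of Hoelder's inequality for the
    moduli.  The norms may be infinite: the real part of [inner] is [fine] of an
    extended integral, and [fine y <= |y|] for every extended real [y]. *)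
Lemma Re_inner_le f h : cmeasurable f -> cmeasurable h ->
  ((complex.Re (inner mu f h))%:E <= L2norm mu f * L2norm mu h)%E.
Proof.
move=> mf mh; rewrite /inner /cintegral /= /Rintegral.
set r := fun x => complex.Re ((f x)^*%C * h x).
have mr : measurable_fun setT (EFin \o r).
  apply/measurable_EFinP; case: mf mh => mRf mIf [mRh mIh].
  rewrite (_ : r = fun x => complex.Re (f x) * complex.Re (h x) +
                            complex.Im (f x) * complex.Im (h x)).
    by apply: measurable_funD; exact: measurable_funM.
  by apply/funext => x; rewrite /r; case: (f x) (h x) => a b [a' b'] /=;
    rewrite mulNr opprK.
have mnf := cmeasurable_normc mf; have mnh := cmeasurable_normc mh.
have fine_le (y : \bar R) : ((fine y)%:E <= `|y|)%E.
  by case: y => [y||] /=; rewrite ?leey ?lee_fin ?ler_norm.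
apply: le_trans (fine_le _) _.
apply: le_trans (le_abse_integral mu measurableT mr) _.
apply: le_trans (hoelder mu mnf mnh _ _ _) => //; last first.
  by rewrite -mulr2n -[_ *+ 2]mulr_natl mulfV.
rewrite Lnorm1; apply: ge0_le_integral => //.
- by apply: measurableT_comp.
- apply: measurableT_comp => //; apply/measurable_EFinP.
  exact: measurable_funM.
move=> x _ /=; rewrite lee_fin.
rewrite [leRHS]ger0_norm ?mulr_ge0 ?normc_ge0// -(normc_conj (f x)) -normcM.
exact: normr_Re_le.
Qed.

End ComplexL2Theory.

(** * Semigroup and generator of a Markov process *)

Section MarkovSemigroup.
Context d (S : measurableType d) (R : realType).
Context d' (Omega : measurableType d').
Variables (X : R -> Omega -> S) (Pr : S -> probability Omega R).
Hypothesis hX : markov_process X Pr.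
Variable mu : probability S R.
Implicit Types (f h : S -> R[i]) (u : S -> R) (t c : R).

(** [mp_transition] gives measurability in [x] only of the law of [X t] under
    [Pr x], not of [Pr x] itself.  The integral is therefore moved to [S] along
    [X t], where the pushforward measures form a kernel, and the general case
    follows from that of the positive and negative parts. *)
Lemma measurable_expectation t u : 0 <= t -> measurable_fun setT u ->
  measurable_fun setT (fun x => \int[Pr x]_w u (X t w)).
Proof.
move=> t0 mu_u; have mX := mp_measurable hX t0.
pose Xt : {mfun Omega >-> S} := HB.pack (X t) (isMeasurableFun.Build _ _ _ _ _ mX).
have ge0_case (v : S -> \bar R) : measurable_fun setT v ->
    (forall y, 0 <= v y)%E ->
    measurable_fun setT (fun x => \int[Pr x]_w v (X t w))%E.
  move=> mv v0.
  rewrite (_ : (fun x => _) =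
      fun x => (\int[pushforward (Pr x) Xt]_y v y)%E); last first.
    apply/funext => x; rewrite ge0_integral_pushforward//.
  apply: (@measurable_fun_integral_kernel _ _ _ _ _
    (fun x => pushforward (Pr x) Xt)) => // A mA.
  exact: (mp_transition hX t0 mA).
move/measurable_EFinP in mu_u.
apply: (measurableT_comp (@fine_measurable R setT measurableT)).
pose v := EFin \o u.
change (measurable_fun setT (fun x => \int[Pr x]_w (v \o X t) w)%E).
under eq_fun do rewrite integralE funepos_comp funeneg_comp.
apply: emeasurable_funB.
- exact: (ge0_case _ (measurable_funepos mu_u) (funepos_ge0 _)).
- exact: (ge0_case _ (measurable_funeneg mu_u) (funeneg_ge0 _)).
Qed.

Lemma cmeasurable_semigroup t f : 0 <= t -> cmeasurable f ->
  cmeasurable (semigroup X Pr t f).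
Proof.
move=> t0 [mRe mIm]; split; rewrite /semigroup /cintegral /=.
- exact: (measurable_expectation t0 mRe).
- exact: (measurable_expectation t0 mIm).
Qed.

Lemma semigroupZ t c f x : 0 <= t -> 0 <= c -> cmeasurable f ->
  semigroup X Pr t (fun y => c%:C%C * f y) x =
  c%:C%C * semigroup X Pr t f x.
Proof.
move=> t0 c0 [mRe mIm]; rewrite /semigroup (@cintegralZ _ _ _ (Pr x) c (f \o X t))//.
have mX := mp_measurable hX t0.
by split; [exact: (measurableT_comp mRe)|exact: (measurableT_comp mIm)].
Qed.

Local Notation quotient t f :=
  (fun x => (t^-1)%:C%C * (semigroup X Pr t f x - f x)).

Lemma cmeasurable_quotient t f : 0 <= t -> cmeasurable f ->
  cmeasurable (quotient t f).
Proof.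
move=> t0 mf; apply: cmeasurableZ; apply: cmeasurableB => //.
exact: cmeasurable_semigroup.
Qed.

Lemma is_generator_atZ c f h : 0 <= c -> cmeasurable f ->
  is_generator_at X Pr mu f h ->
  is_generator_at X Pr mu (fun x => c%:C%C * f x) (fun x => c%:C%C * h x).
Proof.
move=> c0 mf [[mh hfin] cvh]; split.
  split; first exact: cmeasurableZ.
  by rewrite L2normZ// lte_mul_pinfty// lee_fin.
have : (c%:E * L2norm mu (fun x => quotient t f x - h x)%R)%E
    @[t --> 0^'+] --> (c%:E * 0)%E by apply: cvgeZl.
rewrite mule0; apply: cvg_trans; apply: near_eq_cvg.
near=> t.
have t0 : 0 <= t by apply: ltW; near: t; exact: nbhs_right_gt.
rewrite -L2normZ//; last exact: (cmeasurableB (cmeasurable_quotient t0 mf)).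
apply: eq_L2norm => x; rewrite semigroupZ//; congr normc; ring.
Unshelve. all: by end_near.
Qed.

(** With [q] the difference quotient at time [t],
    |h1| <= |q - h1| + |q - h2| + |h2|, and the first two terms vanish as [t]
    tends to 0.  Exchanging [h1] and [h2] shows that the norm of the generator
    does not depend on the representative. *)
Lemma is_generator_at_L2norm_le f h1 h2 : cmeasurable f ->
  is_generator_at X Pr mu f h1 -> is_generator_at X Pr mu f h2 ->
  (L2norm mu h1 <= L2norm mu h2)%E.
Proof.
move=> mf [[mh1 _] cv1] [[mh2 fin2] cv2].
have cv : (L2norm mu (fun x => quotient t f x - h1 x)%R
         + L2norm mu (fun x => quotient t f x - h2 x)%R
         + L2norm mu h2)%E @[t --> 0^'+] --> L2norm mu h2.
  rewrite -[X in _ --> X]add0e -[X in _ --> (X + _)%E]add0e.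
  apply: cvgeD; [by rewrite add0e fin_num_adde_defr| |exact: cvg_cst].
  by apply: cvgeD cv1 cv2; rewrite fin_num_adde_defr.
apply: cvge_ge cv.
near=> t.
have t0 : 0 <= t by apply: ltW; near: t; exact: nbhs_right_gt.
have mq := cmeasurable_quotient t0 mf.
have h12 : (L2norm mu (fun x => h1 x - h2 x)%R <=
    L2norm mu (fun x => quotient t f x - h1 x)%R
  + L2norm mu (fun x => quotient t f x - h2 x)%R)%E.
  apply: le_L2norm_add; try exact: cmeasurableB.
  move=> x; rewrite (normc_subC (quotient t f x) (h1 x)).
  apply: le_trans (le_normcD _ _); rewrite addrA subrK//.
apply: le_trans (leeD2r _ h12).
apply: le_L2norm_add => //; first exact: cmeasurableB.
by move=> x; apply: le_trans (le_normcD _ _); rewrite subrK.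
Unshelve. all: by end_near.
Qed.

Lemma generatorP f : Dom X Pr mu f ->
  is_generator_at X Pr mu f (generator X Pr mu f).
Proof. by case=> _ exh; exact: (xgetPex (fun=> 0) exh). Qed.

End MarkovSemigroup.

(** * Comparison of the two gaps *)

Theorem proposition3 (R : realType) (d d' : measure_display)
    (S : measurableType d) (Omega : measurableType d')
    (X : R -> Omega -> S) (Pr : S -> probability Omega R)
    (mu : probability S R)
    (hX : markov_process X Pr)
    (hinv : invariant_measure X Pr mu)
    (hcont : strongly_continuous X Pr mu) :
  (gap_s X Pr mu <= gap X Pr mu)%E.
Proof.
apply: le_ereal_inf_tmp => _ [f [[Df [[mf ffin] f0]] fN0] <-].
have normf_neq0 : L2norm mu f != 0%E.
  apply/eqP => /(Lnorm_eq0_eq0 _ _) Nf0; apply: fN0.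
  have {Nf0} : \forall x \ae mu, setT x -> (normc (f x))%:E = 0%E :> \bar R.
    by apply: Nf0 => //; apply/measurable_EFinP; exact: cmeasurable_normc.
  by apply: filterS => x /(_ I) [] /eq0_normc.
have := L2norm_ge0 mu f.
move: ffin normf_neq0.
case normf : (L2norm mu f) => [n||]// _; rewrite eqe lee_fin => n_neq0 n_ge0.
have c_ge0 : 0 <= n^-1 by rewrite invr_ge0.
pose g := fun x => (n^-1)%:C%C * f x.
have Dgen := generatorP Df.
have mgen : cmeasurable (generator X Pr mu f) by case: Dgen => -[].
have gengP := is_generator_atZ hX c_ge0 mf Dgen.
have mg : cmeasurable g by exact: cmeasurableZ.
have normg : L2norm mu g = 1%E by rewrite L2normZ// normf -EFinM mulVf.
have L2g : L2 mu g by split=> //; rewrite normg ltry.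
have Dg : Dom X Pr mu g by split=> //; eexists; exact: gengP.
have mgeng : cmeasurable (generator X Pr mu g) by case: (generatorP Dg) => -[].
apply: (@le_trans _ _ (complex.Re (inner mu g (fun x => - generator X Pr mu g x)))%:E).
  apply: ereal_inf_lbound; exists g => //; split=> //; split=> //; split=> //.
  by rewrite cintegralZ// f0 mulr0.
have mNgeng := cmeasurableN mgeng.
apply: (le_trans (Re_inner_le mu mg mNgeng)).
rewrite normg mul1e.
rewrite (@eq_L2norm _ _ _ mu _ (generator X Pr mu g)); last by move=> x; exact: normcN.
apply: (le_trans (is_generator_at_L2norm_le hX mg (generatorP Dg) gengP)).
by rewrite L2normZ// muleC inver (negbTE n_neq0).
Qed.
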